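(* Let $G$ be a graph on $n$ vertices with vertex set $V$. If $\alpha(G \setminus \{v\}) = \alpha(G)$ holds for $m$ choices of $v \in V$ (that is, for $m$ distinct vertices $v$), then $$\alpha(G) \le \left\lfloor n - \frac{m}{2} \right\rfloor.$$
   Context: All graphs are finite, undirected, and simple. $\alpha(G)$ denotes the independence number of $G$ (with $\alpha = 0$ for the graph with no vertices), and $G\setminus\{v\}$ denotes the induced subgraph of $G$ on $V\setminus\{v\}$. *)

(* Defs.v *)
From HB Require Import structures.
From mathcomp Require Import all_boot all_order all_algebra.

Set Implicit Arguments.
Unset Strict Implicit.
Unset Printing Implicit Defensive.

Record sgraph := SGraph {
  vertex :> finType;
  adj : rel vertex;
  adj_sym : symmetric adj;
  adj_irrefl : irreflexive adj
}.

Section Induced.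
Variables (G : sgraph) (A : {set G}).

Definition induced_adj : rel {x : G | x \in A} :=
  fun x y => adj (val x) (val y).

Lemma induced_adj_sym : symmetric induced_adj.
Proof. by move=> x y; exact: adj_sym. Qed.

Lemma induced_adj_irrefl : irreflexive induced_adj.
Proof. by move=> x; exact: adj_irrefl. Qed.

Definition induced : sgraph := SGraph induced_adj_sym induced_adj_irrefl.

End Induced.

Definition del_vertex (G : sgraph) (v : G) : sgraph := induced [set~ v].

Definition independent (G : sgraph) (S : {set G}) : bool :=
  [forall x in S, forall y in S, ~~ adj x y].

(* The set of independent sets is never empty (it contains [set0]), so the
   default value 0 of [\max] plays no role. *)
Definition alpha (G : sgraph) : nat :=
  \max_(S : {set G} | independent S) #|S|.

(* Main.v *)
(** Fix maximum independent sets [T v] avoiding each [v] of [M]. Processing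
    them one at a time, keep the intersection [I] and the union [U] of the
    family met so far; no vertex of [I] is adjacent to a vertex of [U].  For a
    new maximum independent set [T], the set [(I :\: T) :|: (T :&: U)] is
    independent, so comparing its size with [#|T|] gives
    [#|I :\: T| <= #|T :\: U|]: what [I] loses, [U] gains.  Hence
    [2 * alpha G <= #|I| + #|U|] throughout, and at the end [I] misses [M]. *)

Require Import Defs.
From mathcomp Require Import all_boot all_order all_algebra.
From mathcomp Require Import zify lra.
Import Order.TTheory GRing.Theory Num.Theory.
Local Open Scope ring_scope.

Lemma independentP (G : sgraph) (S : {set G}) :
  reflect {in S &, forall x y, ~~ adj x y} (independent S).
Proof.
apply: (iffP forall_inP) => [indS x y xS yS|indS x xS].
  exact: (forall_inP (indS x xS)).
by apply/forall_inP => y yS; apply: indS.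
Qed.

Lemma independent_le_alpha (G : sgraph) (S : {set G}) :
  independent S -> (#|S| <= alpha G)%N.
Proof. by move=> indS; rewrite /alpha (bigop.bigmax_sup S). Qed.

Lemma alpha_witness (G : sgraph) :
  exists2 S : {set G}, independent S & #|S| = alpha G.
Proof.
have ind0 : independent (set0 : {set G}).
  by apply/independentP => x y; rewrite inE.
have [|S indS alphaE] :=
    @eq_bigmax_cond _ (@independent G) (fun S : {set G} => #|S|).
  by apply/card_gt0P; exists set0.
by exists S => //; rewrite /alpha alphaE.
Qed.

Lemma alpha_del_vertex_witness (G : sgraph) (v : G) :
  exists S : {set G},
    [/\ independent S, #|S| = alpha (del_vertex v) & v \notin S].
Proof.
have [S indS cardS] := alpha_witness (del_vertex v).
exists [set val x | x in S]; split.
- apply/independentP => _ _ /imsetP[x xS ->] /imsetP[y yS ->].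
  exact: (independentP _ _ indS x y xS yS).
- by rewrite card_imset //; apply: val_inj.
- by apply/imsetP => -[x _ vx]; have := valP x; rewrite -vx !inE eqxx.
Qed.

Lemma card_setD_exchange (G : sgraph) (I U T : {set G}) :
  I \subset U -> {in I & U, forall x y, ~~ adj x y} ->
  independent T -> #|T| = alpha G -> (#|I :\: T| <= #|T :\: U|)%N.
Proof.
move=> /subsetP sIU nadjIU /independentP indT cardT.
have indX : independent ((I :\: T) :|: (T :&: U)).
  apply/independentP => x y; rewrite !inE.
  (* Both pieces lie in [U], so [nadjIU] settles every pair that meets [I]; a pair inside [T :&: U]
     is left to [indT]. *)
  move=> /orP[/andP[_ xI]|/andP[xT xU]] /orP[/andP[_ yI]|/andP[yT yU]].
  - by apply: nadjIU => //; apply: sIU.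
  - exact: nadjIU.
  - by rewrite adj_sym; apply: nadjIU.
  - exact: indT.
(* Splitting [T] along [U] lets the common term [#|T :&: U|] cancel. *)
have := independent_le_alpha _ _ indX; rewrite -cardT -(cardsID U T).
have /eqP disj : (I :\: T) :&: (T :&: U) == set0.
  by apply/eqP/setP => x; rewrite !inE; case: (x \in T); rewrite ?andbF.
by rewrite cardsU disj cards0 subn0 addnC leq_add2l.
Qed.

Lemma core_corona (G : sgraph) (s : seq G) :
  {in s, forall v, alpha (del_vertex v) = alpha G} ->
  exists I U : {set G},
    [/\ I \subset U, {in I & U, forall x y, ~~ adj x y},
        (2 * alpha G <= #|I| + #|U|)%N & {in s, forall v, v \notin I}].
Proof.
elim: s => [_|v s IHs alphaE].
  have [S /independentP indS cardS] := alpha_witness G.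
  (* Any maximum independent set starts the family, so an empty [s] is covered too. *)
  by exists S, S; split => //; rewrite cardS mul2n addnn.
have [w ws|I [U [sIU nadjIU leIU sI]]] := IHs.
  by apply: alphaE; rewrite inE ws orbT.
have [T [indT]] := alpha_del_vertex_witness G v.
rewrite alphaE ?mem_head // => cardT vT.
exists (I :&: T), (U :|: T); split.
- by rewrite subIset // (subset_trans sIU) ?subsetUl.
- move=> x y; rewrite !inE => /andP[xI xT] /orP[yU|yT]; first exact: nadjIU.
  exact: (independentP _ _ indT).
(* [#|I :&: T| + #|U :|: T|] equals [#|I| + #|U| - #|I :\: T| + #|T :\: U|]. *)
- have := card_setD_exchange _ _ _ _ sIU nadjIU indT cardT.
  have := cardsID T I; have := cardsID U T; have := cardsUI U T.
  rewrite (setIC U T); lia.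
- move=> w; rewrite !inE => /predU1P[->|/sI /negPf->] //.
  by rewrite (negPf vT) andbF.
Qed.

Theorem corollary3 (G : sgraph) (n m : nat) (M : {set G})
  (hn : #|G| = n) (hm : #|M| = m)
  (hM : forall v : G, v \in M -> alpha (del_vertex v) = alpha G) :
  (alpha G)%:Z <= Num.floor (n%:R - m%:R / 2 : rat).
Proof.
have [|I [U [_ _ leIU MI]]] := core_corona G (enum M).
  by move=> v; rewrite mem_enum; apply: hM.
have leI : (#|I| <= #|~: M|)%N.
  apply/subset_leq_card/subsetP => v vI; rewrite inE.
  by apply: contraL vI => vM; apply: MI; rewrite mem_enum.
(* Here [#|I| <= n - m] and [#|U| <= n]; keeping the bound doubled and additive avoids halving and
   truncated subtraction in [nat]. *)
have le2 : (2 * alpha G + m <= 2 * n)%N.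
  have := cardsC M; have := max_card U; rewrite hm hn; lia.
have : (2 * alpha G + m)%:R <= (2 * n)%:R :> rat by rewrite ler_nat.
(* An integer is at most a floor exactly when it is at most the number itself. *)
rewrite natrD !natrM floor_ge_int pmulrn => ?; lra.
Qed.
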